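(* For every integer $n\ge 6$ with $n\equiv 2\pmod 4$ there exists a $17$-MOFS$(n)$, i.e. a set of $17$ pairwise orthogonal binary frequency squares of order $n$.
   Context: Let $N(n)=\{1,\dots,n\}$ and let $n$ be even. A (binary) frequency square of order $n$ is an $n\times n$ array indexed by $N(n)\times N(n)$ with entries in $\{0,1\}$ such that every row and every column contains exactly $n/2$ zeros and $n/2$ ones. Two frequency squares $F,G$ of order $n$ are orthogonal if for each $(a,b)\in\{0,1\}^2$ the number of cells $(r,c)$ with $(F[r,c],G[r,c])=(a,b)$ equals $n^2/4$. A $k$-MOFS$(n)$ is a set of $k$ pairwise orthogonal frequency squares of order $n$. *)

(* Defs.v *)
From mathcomp Require Import all_boot all_algebra.

Set Implicit Arguments.
Unset Strict Implicit.
Unset Printing Implicit Defensive.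

(* Symbols 0 and 1 are encoded as false and true, and N(n) as 'I_n.
   For odd n no matrix satisfies this predicate, so the truncated halving n./2
   is the exact n/2 wherever the predicate holds. *)
Definition frequency_square (n : nat) (F : 'M[bool]_n) : Prop :=
  (forall (r : 'I_n) (a : bool), #|[set c : 'I_n | F r c == a]| = n./2) /\
  (forall (c : 'I_n) (a : bool), #|[set r : 'I_n | F r c == a]| = n./2).

Definition orthogonal_squares (n : nat) (F G : 'M[bool]_n) : Prop :=
  forall a b : bool,
    #|[set rc : 'I_n * 'I_n |
        (F rc.1 rc.2 == a) && (G rc.1 rc.2 == b)]| = n ^ 2 %/ 4.

Definition MOFS (k n : nat) (S : {set 'M[bool]_n}) : Prop :=
  [/\ #|S| = k,
      forall F, F \in S -> frequency_square F
    & forall F G, F \in S -> G \in S -> F != G -> orthogonal_squares F G].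

(* Main.v *)
Require Import Defs.
From mathcomp Require Import all_boot all_algebra.
From Stdlib Require Import NArith.
From mathcomp Require Import zify.

(** Call a family of m x p binary arrays balanced if all rows and columns are
    balanced and any two members disagree in exactly half of the cells.  Gluing
    arrays side by side, stacking them and transposing them preserve
    balancedness, so for n = 6 + 4b with b >= 2 it suffices to glue 17 arrays of
    each of the shapes 6 x 6, 6 x 4b, 4b x 6 and 4b x 4b, and the last three
    are cut into pieces of shapes 6 x 8, 6 x 12, 4 x 8 and 4 x 12.  These pieces
    come from the rows of the normalised Hadamard matrices of orders 4, 8 and 12.
    The cases n = 6 and n = 10 are given by explicit squares found by computer. *)

Definition balanced_family (k m p : nat) (F : nat -> nat -> nat -> bool) : Prop :=
  [/\ forall i r, i < k -> r < m -> (\sum_(0 <= c < p) F i r c).*2 = p,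
      forall i c, i < k -> c < p -> (\sum_(0 <= r < m) F i r c).*2 = m
    & forall i j, i < k -> j < k -> i != j ->
        (\sum_(0 <= r < m) \sum_(0 <= c < p) (F i r c (+) F j r c)).*2 = m * p].

Definition has_balanced_family k m p := exists F, balanced_family k m p F.

Lemma balanced_family_tr k m p :
  has_balanced_family k m p -> has_balanced_family k p m.
Proof.
move=> [F [Hr Hc Ho]]; exists (fun i r c => F i c r); split.
- by move=> i r; apply: Hc.
- by move=> i c; apply: Hr.
- by move=> i j ik jk ij; rewrite exchange_big_nat /= Ho // mulnC.
Qed.

Lemma sum_nat_if_cat (f g : nat -> nat) p q :
  \sum_(0 <= c < p + q) (if c < p then f c else g (c - p)) =
  \sum_(0 <= c < p) f c + \sum_(0 <= c < q) g c.
Proof.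
rewrite (big_cat_nat (leq0n p)) ?leq_addr //=; congr (_ + _).
  by apply: eq_big_nat => c /andP[_ ->].
rewrite -{1}[p]add0n big_addn addKn.
by apply: eq_big_nat => c _; rewrite ltnNge leq_addl addnK.
Qed.

Lemma balanced_family_row k m p q :
  has_balanced_family k m p -> has_balanced_family k m q ->
  has_balanced_family k m (p + q).
Proof.
move=> [F [Fr Fc Fo]] [G [Gr Gc Go]].
exists (fun i r c => if c < p then F i r c else G i r (c - p)); split.
- move=> i r ik rm; rewrite -[RHS](congr2 addn (Fr i r ik rm) (Gr i r ik rm)).
  rewrite -doubleD -sum_nat_if_cat; congr (_.*2).
  by apply: eq_bigr => c _; case: ifP.
- move=> i c ik cpq; case: ltnP => cp; first exact: Fc.
  by apply: Gc => //; rewrite ltn_subLR.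
- move=> i j ik jk ij; rewrite mulnDr -(Fo i j) // -(Go i j) // -doubleD.
  rewrite -big_split /=; congr (_.*2); apply: eq_bigr => r _.
  by rewrite -sum_nat_if_cat; apply: eq_bigr => c _; case: ifP.
Qed.

Lemma balanced_family_col k m n p :
  has_balanced_family k m p -> has_balanced_family k n p ->
  has_balanced_family k (m + n) p.
Proof.
by move=> /balanced_family_tr Km /balanced_family_tr Kn;
  apply: balanced_family_tr; apply: balanced_family_row.
Qed.

(* [sumn] over [iota] computes, whereas [bigop] is locked. *)
Definition balanced_familyb k m p (F : nat -> nat -> nat -> bool) : bool :=
  let S q f := sumn [seq f x | x <- iota 0 q] in
  [&& all (fun i => all (fun r => (S p (F i r : nat -> nat)).*2 == p) (iota 0 m))
          (iota 0 k),
      all (fun i => all (fun c => (S m (fun r => F i r c : nat)).*2 == m) (iota 0 p))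
          (iota 0 k)
    & all (fun i => all (fun j => (i == j) ||
          ((S m (fun r => S p (fun c => F i r c (+) F j r c : nat))).*2 == m * p))
          (iota 0 k)) (iota 0 k)].

Lemma balanced_familyP k m p F :
  balanced_familyb k m p F -> balanced_family k m p F.
Proof.
have S q f : \sum_(0 <= x < q) f x = sumn [seq f x | x <- iota 0 q].
  by rewrite sumnE big_map /index_iota subn0.
have io x q : x < q -> x \in iota 0 q by rewrite mem_iota.
case/and3P=> /allP Hr /allP Hc /allP Ho; split.
- by move=> i r /io /Hr/allP Hi /io /Hi /eqP; rewrite S.
- by move=> i c /io /Hc/allP Hi /io /Hi /eqP; rewrite S.
- move=> i j /io /Ho/allP Hi /io /Hi /orP[-> //|/eqP <- _].
  by rewrite S; congr (sumn _).*2; apply: eq_map => r; rewrite S.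
Qed.

(* Row [a] of the normalised Paley Hadamard matrix of order q + 1, for a prime
   q = 3 mod 4: the translate by [a] of the nonzero squares mod q, together with
   the point [q] at infinity.  The all-one row is omitted. *)
Definition paley (q a c : nat) : bool :=
  (c == q) || has (fun x => x * x == c + (q - a) %[mod q]) (iota 1 q.-1).

(** In signs, each array is the outer product of a Hadamard row of order 4 and one of order 8, [i]
    coding one of [3 * 7] pairs of rows. Distinct pairs differ in some factor, whose rows are
    orthogonal, so the products are orthogonal. *)
Lemma balanced_family_4_8 : has_balanced_family 17 4 8.
Proof.
exists (fun i r c => paley 3 (i %/ 7) r (+) paley 7 (i %% 7) c).
by apply: balanced_familyP; vm_compute.
Qed.

Lemma balanced_family_4_12 : has_balanced_family 17 4 12.
Proof.
exists (fun i r c => paley 3 (i %/ 11) r (+) paley 11 (i %% 11) c).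
by apply: balanced_familyP; vm_compute.
Qed.

(* Words of length 6 over the signed letters +0, ..., +6, -0, ..., -6, the letter
   -a being encoded as a + 7.  Each letter occurs equally often with both signs
   in a word, and any two words have as many places with equal letters as
   places with opposite letters.  Replacing the letters by the corresponding rows
   of a Hadamard matrix turns these into balanced columns and orthogonality. *)
Definition signed_words : seq (seq nat) :=
  [:: [:: 9; 4; 2; 0; 7; 11]; [:: 2; 9; 2; 2; 9; 9]; [:: 1; 12; 5; 8; 1; 8];
     [:: 4; 1; 12; 11; 5; 8]; [:: 8; 1; 5; 3; 10; 12]; [:: 11; 4; 11; 11; 4; 4];
     [:: 6; 13; 6; 6; 13; 13]; [:: 2; 4; 7; 9; 11; 0]; [:: 11; 6; 4; 1; 13; 8];
     [:: 12; 1; 8; 5; 12; 5]; [:: 12; 5; 1; 8; 13; 6]; [:: 6; 2; 10; 13; 9; 3];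
     [:: 3; 10; 10; 3; 3; 10]; [:: 0; 7; 13; 6; 9; 2]; [:: 12; 6; 11; 4; 5; 13];
     [:: 0; 0; 7; 7; 4; 11]; [:: 3; 5; 8; 10; 1; 12]].

Definition word_array (q i r c : nat) : bool :=
  let x := nth 0 (nth [::] signed_words i) r in (6 < x) (+) paley q (x %% 7) c.

Lemma balanced_family_6_8 : has_balanced_family 17 6 8.
Proof.
by exists (word_array 7); apply: balanced_familyP; vm_compute.
Qed.

(** The letters 0 to 6 pick only seven of the eleven rows, so the words used for order 8 serve
    again. *)
Lemma balanced_family_6_12 : has_balanced_family 17 6 12.
Proof.
by exists (word_array 11); apply: balanced_familyP; vm_compute.
Qed.

(* Each square is a number whose bit [n * r + c] is the entry [(r, c)]. *)
Definition mofs6 : seq N :=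
  [:: 0xd0da72393; 0x378996a53; 0xd264daa4d; 0x4cd99ad29; 0xcb8a951cd;
    0x7315a33a9; 0x2d6e32365; 0x3a9656ca5; 0x1ecca9695; 0x59ac4db23;
    0xa74c4e58b; 0x1f2378999; 0x99c723c4b; 0xa87d15a99; 0x6a56ac953;
    0xb13a8bd15; 0x726b194e3]%num.

Definition mofs10 : seq N :=
  [:: 0x71b385658726ca7ac66cda256; 0x3e24d4e9e135acac59a58af15;
    0xe172a1d9781ea93a3ac94d5c5; 0x27b135a6c31eb075b1d4ad2a9;
    0x63475e0d2e9c99a997c836a35; 0xa713c4aec3e91e19aa9915d56;
    0xa2eaadc315789e4177072e85d; 0xc3791ab19696a691e96538d96;
    0xf410f0de748ade23c55ca2f8c; 0x3ab70e317429f139e11ba34c7;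
    0x27aa6e0e390fb49f04765a5d4; 0x4b8f20ee658e69c76385f0947;
    0x5b32c35a8bcc9d137127966a3; 0xc9a35ce1c9ec25629c5e32dc9;
    0xf227149e4d54fa8a581f790ba; 0xd62b42ccae7470716fc28b56c;
    0x52d6a8bb892d73254ee43569c]%num.

Definition bit_array (n : nat) (s : seq N) (i r c : nat) : bool :=
  N.testbit (nth 0%num s i) (N.of_nat (n * r + c)).

Lemma balanced_family_6_6 : has_balanced_family 17 6 6.
Proof.
by exists (bit_array 6 mofs6); apply: balanced_familyP; vm_compute.
Qed.

Lemma balanced_family_10_10 : has_balanced_family 17 10 10.
Proof.
by exists (bit_array 10 mofs10); apply: balanced_familyP; vm_compute.
Qed.

(** The induction peels off strips of width 8, down to a last strip of width 8 or 12. *)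
Lemma balanced_family_mul4 k m b :
  has_balanced_family k m 8 -> has_balanced_family k m 12 ->
  has_balanced_family k m (4 * b.+2).
Proof.
move=> K8 K12; elim/ltn_ind: b => -[|[|b]] IH //.
have -> : 4 * b.+4 = 8 + 4 * b.+2 by lia.
by apply: balanced_family_row => //; apply: IH.
Qed.

Lemma balanced_family_4_mul4 a b : has_balanced_family 17 (4 * a.+1) (4 * b.+2).
Proof.
have K4 : has_balanced_family 17 4 (4 * b.+2).
  exact: balanced_family_mul4 balanced_family_4_8 balanced_family_4_12.
elim: a => [//|a IH].
have -> : 4 * a.+2 = 4 + 4 * a.+1 by lia.
exact: balanced_family_col.
Qed.

Lemma balanced_family_mod4_2 n :
  6 <= n -> n = 2 %[mod 4] -> has_balanced_family 17 n n.
Proof.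
move=> n6 n4; have [b ->] : exists b, n = 6 + 4 * b.
  by exists ((n - 6) %/ 4); lia.
case: b => [|[|b]]; first exact: balanced_family_6_6.
  exact: balanced_family_10_10.
have K6 : has_balanced_family 17 6 (4 * b.+2).
  exact: balanced_family_mul4 balanced_family_6_8 balanced_family_6_12.
apply: balanced_family_col; apply: balanced_family_row => //.
- exact: balanced_family_6_6.
- exact: balanced_family_tr.
- exact: balanced_family_4_mul4.
Qed.

Lemma card_set_eq_bool (I : finType) (f : I -> bool) h :
  (\sum_x f x).*2 = #|I| -> #|I| = h.*2 ->
  forall a, #|[set x | f x == a]| = h.
Proof.
move=> fI Ih; pose N a := \sum_x (f x == a).
have cN a : #|[set x | f x == a]| = N a.
  by rewrite -sum1dep_card big_mkcond; apply: eq_bigr => x _; case: eqP.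
have Nf : N true = \sum_x f x by apply: eq_bigr => x _; case: (f x).
have NI : N true + N false = #|I|.
  by rewrite -big_split -sum1_card; apply: eq_bigr => x _; case: (f x).
by case; rewrite cN; lia.
Qed.

(** The two margins, the number of disagreements and the total give four independent linear
    equations for the four counts, with [q] everywhere as the only solution. *)
Lemma card_set_eq_bool2 (I : finType) (f g : I -> bool) q :
  (\sum_x f x).*2 = #|I| -> (\sum_x g x).*2 = #|I| ->
  (\sum_x (f x (+) g x)).*2 = #|I| -> #|I| = 4 * q ->
  forall a b, #|[set x | (f x == a) && (g x == b)]| = q.
Proof.
move=> fI gI fgI Iq.
pose N a b := \sum_x ((f x == a) && (g x == b)).
have cN a b : #|[set x | (f x == a) && (g x == b)]| = N a b.
  by rewrite -sum1dep_card big_mkcond; apply: eq_bigr => x _; case: andb.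
have Nf : N true true + N true false = \sum_x f x.
  by rewrite -big_split; apply: eq_bigr => x _; case: (f x); case: (g x).
have Ng : N true true + N false true = \sum_x g x.
  by rewrite -big_split; apply: eq_bigr => x _; case: (f x); case: (g x).
have Nfg : N true false + N false true = \sum_x (f x (+) g x).
  by rewrite -big_split; apply: eq_bigr => x _; case: (f x); case: (g x).
have NI : N true true + N true false + (N false true + N false false) = #|I|.
  rewrite -!big_split -sum1_card.
  by apply: eq_bigr => x _; case: (f x); case: (g x).
by case=> [] []; rewrite cN; lia.
Qed.

Lemma MOFS_of_balanced_family k h :
  0 < h -> has_balanced_family k h.*2 h.*2 ->
  exists S : {set 'M[bool]_h.*2}, MOFS k S.
Proof.
set n := h.*2 => h0 [F [Hr Hc Ho]].
pose M (i : 'I_k) : 'M[bool]_n := (\matrix_(r, c) F i r c)%R.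
have ord_sum (f : nat -> nat) : \sum_(x < n) f x = \sum_(0 <= x < n) f x.
  by rewrite big_mkord.
have pair_sum (f : nat -> nat -> nat) :
    \sum_(x : 'I_n * 'I_n) f x.1 x.2 = \sum_(0 <= r < n) \sum_(0 <= c < n) f r c.
  rewrite -(pair_bigA _ (fun r c : 'I_n => f r c)) /= -ord_sum.
  by apply: eq_bigr => r _; rewrite ord_sum.
have card_pair : #|{: 'I_n * 'I_n}| = n * n by rewrite card_prod card_ord.
have cells (i : 'I_k) : (\sum_(x : 'I_n * 'I_n) M i x.1 x.2).*2 = n * n.
  under eq_bigr do rewrite mxE.
  rewrite (pair_sum (fun r c => F i r c)).
  rewrite (@eq_big_nat _ _ _ _ _ _ (fun=> h)) => [|r /andP[_ rn]].
    by rewrite sum_nat_const_nat subn0 doubleMr.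
  by apply: double_inj; rewrite Hr.
have M_xor (i j : 'I_k) : i != j ->
    (\sum_(x : 'I_n * 'I_n) (M i x.1 x.2 (+) M j x.1 x.2)).*2 = n * n.
  move=> ij; under eq_bigr do rewrite !mxE.
  by rewrite (pair_sum (fun r c => F i r c (+) F j r c)) Ho.
exists [set M i | i : 'I_k]; split.
(* Squares of distinct indices differ: equal ones would disagree nowhere, whereas [M_xor] asks for
   half of the [n * n] cells, a positive number since [0 < h]. *)
- rewrite card_imset ?card_ord // => i j Mij; apply/eqP/negPn/negP => /M_xor.
  by rewrite Mij big1 => [|x _]; rewrite ?addbb // /n; nia.
- move=> _ /imsetP[i _ ->]; split=> [r | c]; rewrite doubleK;
    apply: card_set_eq_bool; rewrite card_ord //.
  + under eq_bigr do rewrite mxE.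
    by rewrite (ord_sum (fun c => F i r c)) Hr.
  + under eq_bigr do rewrite mxE.
    by rewrite (ord_sum (fun r => F i r c)) Hc.
- move=> _ _ /imsetP[i _ ->] /imsetP[j _ ->] Mij.
  have ij : i != j by apply: contraNneq Mij => ->.
  apply: card_set_eq_bool2; rewrite card_pair ?cells ?M_xor // /n.
  (* The quotient is exact: [n ^ 2 %/ 4] is [h ^ 2]. *)
  by rewrite -mul2n expnMn mulKn //; lia.
Qed.

Theorem theorem6p8 (n : nat) (n_ge6 : 6 <= n) (n_mod4 : n = 2 %[mod 4]) :
  exists S : {set 'M[bool]_n}, MOFS 17 S.
Proof.
have nE : n = n./2.*2 by lia.
have := balanced_family_mod4_2 n n_ge6 n_mod4; rewrite nE.
by apply: MOFS_of_balanced_family; lia.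
Qed.
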